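(* Let $T = \langle S, Act, \to\rangle$ be a labelled transition system and let $s, s' \in S$ be arbitrary states. Then $s$ and $s'$ are completed trace equivalent in $T$ if and only if $s$ and $s'$ are trace equivalent in the Kripke structure $\mathsf{ks}(T)$.
   Context: A Kripke structure is $K=\langle S, AP, \to, L\rangle$ with $S$ a set of states, $AP$ a set of atomic propositions, $\to\,\subseteq S\times S$ a total transition relation (for every $s\in S$ there is $t\in S$ with $s\to t$), and $L: S\to 2^{AP}$ a state labelling. A labelled transition system (LTS) is $T=\langle S, Act, \to\rangle$ with $S$ a set of states, $Act$ a set of actions, a special silent action $\tau\notin Act$, and a transition relation $\to\,\subseteq S\times(Act\cup\{\tau\})\times S$ that is total (for every $s\in S$ there are $a\in Act$, $t\in S$ with $s\xrightarrow{a}t$). The embedding $\mathsf{ks}$: for an LTS $T=\langle S,Act,\to\rangle$, $\mathsf{ks}(T)=\langle S', AP, \to', L\rangle$ where $S' = S\cup\{(s,a,t)\in\,\to \mid a\neq\tau\}$, $AP = Act\cup\{\bot\}$ with $\bot\notin Act$ fresh, $\to'$ is the least relation such that for every transition $(s,a,t)$ with $a\neq\tau$ we have $s\to'(s,a,t)$ and $(s,a,t)\to' t$, and $s\to' t$ whenever $s\xrightarrow{\tau}t$; and $L(s)=\{\bot\}$ for $s\in S$, $L((s,a,t))=\{a\}$. Trace equivalence in a Kripke structure: a path from $s$ is an infinite sequence $s_0 s_1\ldots$ of states with $s_0=s$ and $s_i\to s_{i+1}$ for all $i$; its trace is the infinite sequence $L(s_0)L(s_1)\ldots$; states $s,s'$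 are trace equivalent iff the set of traces of paths from $s$ equals the set of traces of paths from $s'$. Completed trace equivalence in an LTS: a run from $s$ is an infinite alternating sequence $s_0 a_0 s_1 a_1\ldots$ with $s_0=s$ and $s_i\xrightarrow{a_i}s_{i+1}$ for all $i$ (the $a_i$ range over $Act\cup\{\tau\}$); its trace is the infinite sequence $a_0a_1\ldots$; states $s,s'$ are completed trace equivalent iff the set of traces of runs from $s$ equals the set of traces of runs from $s'$. *)

(* Defs.v *)
From mathcomp Require Import all_boot.
From mathcomp Require Import boolp classical_sets.

Set Implicit Arguments.
Unset Strict Implicit.
Unset Printing Implicit Defensive.

Local Open Scope classical_set_scope.

Record kripke := Kripke {
  kstate : Type;
  kprop : Type;
  kstep : kstate -> kstate -> Prop;
  klabel : kstate -> set kprop;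
  kstep_total : forall s, exists t, kstep s t }.

Definition kpath (K : kripke) (s : kstate K) : set (nat -> kstate K) :=
  [set p | p 0 = s /\ forall i, kstep (p i) (p i.+1)].

Definition ktrace (K : kripke) (p : nat -> kstate K) : nat -> set (kprop K) :=
  fun i => klabel (p i).

Definition ktraces (K : kripke) (s : kstate K) : set (nat -> set (kprop K)) :=
  @ktrace K @` kpath s.

Definition trace_equivalent (K : kripke) (s s' : kstate K) : Prop :=
  ktraces s = ktraces s'.

(* Act together with the silent action is [option Act]: [None] is tau, and
   [Some a] is the visible action a.  Totality asks every state for an outgoing
   transition with an action in Act, i.e. a visible one. *)
Record lts := Lts {
  lstate : Type;
  lact : Type;
  lstep : lstate -> option lact -> lstate -> Prop;
  lstep_total : forall s, exists (a : lact) (t : lstate), lstep s (Some a) t }.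

Definition tau {T : lts} : option (lact T) := None.

(* A run s_0 a_0 s_1 a_1 ... is the pair of its state and action sequences. *)
Definition lrun (T : lts) (s : lstate T) :
    set ((nat -> lstate T) * (nat -> option (lact T))) :=
  [set r | r.1 0 = s /\ forall i, lstep (r.1 i) (r.2 i) (r.1 i.+1)].

Definition ltraces (T : lts) (s : lstate T) : set (nat -> option (lact T)) :=
  snd @` lrun s.

Definition completed_trace_equivalent (T : lts) (s s' : lstate T) : Prop :=
  ltraces s = ltraces s'.

Section Ks.
Variable T : lts.

Definition visible : set (lstate T * lact T * lstate T) :=
  [set e | lstep e.1.1 (Some e.1.2) e.2].

Definition ks_state : Type := (lstate T + set_type visible)%type.

Definition vsource (e : set_type visible) : lstate T := (val e).1.1.
Definition vaction (e : set_type visible) : lact T := (val e).1.2.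
Definition vtarget (e : set_type visible) : lstate T := (val e).2.

(* AP = Act + {bot} is again an [option] type, where [None] now stands for the
   fresh proposition bot. *)
Definition bot : option (lact T) := None.

Inductive ks_step : ks_state -> ks_state -> Prop :=
| ks_step_enter (e : set_type visible) : ks_step (inl (vsource e)) (inr e)
| ks_step_leave (e : set_type visible) : ks_step (inr e) (inl (vtarget e))
| ks_step_tau (s t : lstate T) : lstep s tau t -> ks_step (inl s) (inl t).

Definition ks_label (x : ks_state) : set (option (lact T)) :=
  match x with
  | inl _ => [set bot]
  | inr e => [set Some (vaction e)]
  end.

Lemma ks_step_total (x : ks_state) : exists y, ks_step x y.
Proof.
case: x => [s|e]; last by exists (inl (vtarget e)); exact: ks_step_leave.
have [a [t st]] := lstep_total s.
have vst : (s, a, t) \in visible by rewrite inE.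
exists (inr (exist _ (s, a, t) vst)).
exact: (ks_step_enter (exist _ (s, a, t) vst)).
Qed.

Definition ks : kripke := Kripke ks_label ks_step_total.

End Ks.

(* Main.v *)
Require Import Defs.
From mathcomp Require Import all_boot.
From mathcomp Require Import boolp classical_sets.

(** The traces of [ks T] are the images of the traces of [T] under the code
    that sends tau to [bot] and a visible action [a] to [bot a].  This code is
    injective on infinite words: every code word starts with [bot], and the
    letter that follows this [bot] tells which action is encoded. *)

Set Implicit Arguments.
Unset Strict Implicit.
Unset Printing Implicit Defensive.

Local Open Scope classical_set_scope.

Section Code.
Variable A : Type.
Implicit Types (w : nat -> option A) (i n : nat).

(** Start of the [i]-th block: tau occupies one place of the code word, a visible action two. *)
Fixpoint code_pos w i : nat :=
  if i is j.+1 then code_pos w j + (isSome (w j)).+1 else 0.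

(* The cursor [(i, b)] points into the code word of [w i], at its visible
   letter when [b] holds and at its leading [bot] otherwise. *)
Definition cursor_next w (c : nat * bool) : nat * bool :=
  if ~~ c.2 && isSome (w c.1) then (c.1, true) else (c.1.+1, false).

Definition cursor w n : nat * bool := iter n (cursor_next w) (0, false).

Definition code w n : set (option A) :=
  [set if (cursor w n).2 then w (cursor w n).1 else None].

Lemma cursorS w n : cursor w n.+1 = cursor_next w (cursor w n).
Proof. by []. Qed.

Lemma cursor_pos w i : cursor w (code_pos w i) = (i, false).
Proof.
elim: i => [//|i IH] /=.
case wi: (w i) => [a|] /=; rewrite ?addn2 ?addn1 !cursorS IH.
  by rewrite /cursor_next /= wi.
by rewrite /cursor_next /= wi.
Qed.

Lemma cursor_posS w i : cursor w (code_pos w i).+1 =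
  if isSome (w i) then (i, true) else (i.+1, false).
Proof. by rewrite cursorS cursor_pos. Qed.

Lemma code_at_pos w i : code w (code_pos w i) = [set None].
Proof. by rewrite /code cursor_pos. Qed.

(** No case split on [w i] is needed: after a tau block comes the [bot] of the next block, and [bot]
    and tau are both [None]. *)
Lemma code_at_posS w i : code w (code_pos w i).+1 = [set w i].
Proof. by rewrite /code cursor_posS; case wi: (w i) => [a|] /=; rewrite ?wi. Qed.

Lemma code_pos_cover w n :
  exists i, n = code_pos w i \/ n = (code_pos w i).+1 /\ isSome (w i).
Proof.
elim: n => [|n [i [->|[-> wi]]]]; first by exists 0; left.
- case wi: (isSome (w i)); first by exists i; right.
  by exists i.+1; left; rewrite /= wi addn1.
- by exists i.+1; left; rewrite /= wi addn2.
Qed.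

Lemma code_inj : injective code.
Proof.
move=> w w' eqc.
have letter i : code_pos w i = code_pos w' i -> w i = w' i.
  move=> eqp; have := code_at_posS w i.
  by rewrite eqc eqp code_at_posS => /seteqP[/(_ (w' i) erefl)].
(* Equal starts of block [i] give equal letters, hence equal block lengths and equal starts of the
   next block. *)
have eqp i : code_pos w i = code_pos w' i.
  by elim: i => [//|i IH] /=; rewrite IH (letter _ IH).
by apply/funext => i; exact/letter/eqp.
Qed.

End Code.

Section Traces.
Variable T : lts.

Lemma vstep (e : set_type (@visible T)) :
  lstep (vsource e) (Some (vaction e)) (vtarget e).
Proof. exact: (set_valP e). Qed.

Lemma ks_step_inl (s : lstate T) (x : ks_state T) : ks_step (inl s) x ->
  match x with inl t => lstep s tau t | inr e => s = vsource e end.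
Proof. by move=> h; inversion h. Qed.

Lemma ks_step_inr (e : set_type (@visible T)) (x : ks_state T) :
  ks_step (inr e) x -> x = inl (vtarget e).
Proof. by move=> h; inversion h. Qed.

Lemma code_in_ktraces (s : lstate T) w :
  ltraces s w -> @ktraces (ks T) (inl s) (code w).
Proof.
case=> -[r w'] [/= r0 rstep] <-.
(* A transition state carries a proof that its transition exists, so it is obtained by choice. For
   tau the chosen state is a dummy that the path [p] never visits. *)
have mid_ex i : exists x : ks_state T, forall a, w' i = Some a ->
    [/\ ks_step (inl (r i)) x, ks_step x (inl (r i.+1)) &
        ks_label x = [set Some a]].
  case wi: (w' i) (rstep i) => [a|] st; last by exists (inl (r i)).
  have vst : (r i, a, r i.+1) \in @visible T by rewrite inE.
  pose e : set_type (@visible T) := exist _ (r i, a, r i.+1) vst.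
  exists (inr e) => _ [<-]; split=> //; first exact: (ks_step_enter e).
  exact: (ks_step_leave e).
have [mid midP] := choice mid_ex.
pose p n : kstate (ks T) :=
  let: (i, b) := cursor w' n in if b then mid i else inl (r i).
have p_pos i : p (code_pos w' i) = inl (r i) by rewrite /p cursor_pos.
have p_posS i : p (code_pos w' i).+1 =
    if isSome (w' i) then mid i else inl (r i.+1).
  by rewrite /p cursor_posS; case: (isSome _).
exists p; first split; first by rewrite (p_pos 0) r0.
- move=> n; have [i [->|[-> wi]]] := code_pos_cover w' n.
    rewrite p_pos p_posS.
    case wi: (w' i) (rstep i) => [a|] st; first by case: (midP _ _ wi).
    exact: ks_step_tau.
  (* A visible block has length two, so its second successor position starts block [i.+1]. *)
  have pS := p_pos i.+1; rewrite /= wi addn2 in pS; rewrite pS p_posS wi.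
  by case: (w' i) wi (midP i) => [a|//] _ /(_ a erefl)[].
apply/funext => n; rewrite /ktrace.
have [i [->|[-> wi]]] := code_pos_cover w' n.
  by rewrite p_pos code_at_pos.
rewrite p_posS code_at_posS wi.
by case: (w' i) wi (midP i) => [a|//] _ /(_ a erefl)[].
Qed.

(** A transition state is always followed by its target, so the path returns to the original states
    after at most two steps; the run consists of these visits. *)
Lemma ktraces_code (s : lstate T) u :
  @ktraces (ks T) (inl s) u -> exists2 w, ltraces s w & u = code w.
Proof.
case=> p [p0 pstep] <-.
(* [q i] is the position of the [i]-th visit to an original state; [jump] skips a transition state
   in between. *)
pose jump n := if p n.+1 is inr _ then n.+2 else n.+1.
pose q i := iter i jump 0.
(* The value on transition states is a mere default: by [pq], [p (q i)] is never one. *)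
pose st (x : ks_state T) := match x with inl t => t | inr e => vsource e end.
pose w i := if p (q i).+1 is inr e then Some (vaction e) else None.
have pq i : p (q i) = inl (st (p (q i))).
  elim: i => [|i IH]; first by rewrite p0.
  rewrite /q /= -/(q i) /jump; case E: (p (q i).+1) => [t|e]; first by rewrite E.
  by have := pstep (q i).+1; rewrite E => /ks_step_inr ->.
have q_pos i : code_pos w i = q i.
  elim: i => [//|i IH] /=; rewrite IH /w /q /= -/(q i) /jump.
  by case: (p (q i).+1) => [t|e]; rewrite ?addn1 ?addn2.
exists w.
  exists (fun i => st (p (q i)), w) => //; split=> [|i] /=; first by rewrite p0.
  have := pstep (q i); rewrite {1}pq /w /q /= -/(q i) /jump.
  case E: (p (q i).+1) => [t|e] /ks_step_inl; first by rewrite E.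
  move=> ->; have := pstep (q i).+1; rewrite E => /ks_step_inr ->.
  exact: vstep.
apply/funext => n; rewrite /ktrace.
have [i [->|[-> wi]]] := code_pos_cover w n.
  by rewrite code_at_pos q_pos pq.
by rewrite code_at_posS q_pos; move: wi; rewrite /w; case: (p _).
Qed.

Lemma ktracesE (s : lstate T) :
  @ktraces (ks T) (inl s) = @code (lact T) @` ltraces s.
Proof.
apply/seteqP; split=> [u /ktraces_code[w sw ->]|_ [w sw <-]]; first by exists w.
exact: code_in_ktraces.
Qed.

End Traces.

Theorem theorem3p20 (T : lts) (s s' : lstate T) :
  completed_trace_equivalent s s' <->
  @trace_equivalent (ks T) (inl s) (inl s').
Proof.
rewrite /completed_trace_equivalent /trace_equivalent !ktracesE.
split=> [-> //|eqc].
(* By injectivity, [w] is a trace exactly when [code w] lies in the image of the traces. *)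
by apply/funext => w; rewrite -2!(image_inj (@code_inj _)) eqc.
Qed.
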